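(* Let $(Z_n)$ be the BPREI induced by the individual-sum controlled branching process of the context, let $\Pi_n:=\prod_{j=0}^{n-1}M_j$ and $V_n:=Z_n/\Pi_n$. For every $r>0$ such that $-r$ lies in the interior of $\mathcal D_\Lambda$ and every $n\ge0$, $$\mathbf E[Z_n^{-r};Z_n>0]=e^{n\Lambda(-r)}\,\mathbf E_{-r}[V_n^{-r};Z_n>0].$$
   Context: Notation: $\mathbf E[Y;B]=\mathbf E[Y\mathbf 1_B]$. Individual-sum controlled process and its induced BPREI: $\xi_{n,j}$ are i.i.d. copies of a nonnegative integer-valued $\xi$ with mean $m\in(0,\infty)$; $(A_n,B_n)$, $n\ge0$, are i.i.d. with $A_n\in\{1,2,\dots\}$, $B_n\in\{0,1,\dots\}$ (possibly dependent on each other); $L_{n,j}$ are i.i.d. copies of a nonnegative integer-valued $L$ with $\lambda:=\mathbf EL\in(0,\infty)$; these families and the initial state are independent. Then $Z_{n+1}:=\sum_{j=1}^{N_n}\xi_{n,j}$ with $N_n:=A_n\sum_{j=1}^{Z_n}L_{n,j}+B_n$; this is a branching process in the random environment $(A_n,B_n)$ with immigration, with quenched reproduction mean $M_n:=m\lambda A_n$. $\Lambda(\vartheta):=\log\mathbf E[M_0^\vartheta]$, $\mathcal D_\Lambda:=\{\vartheta\in\mathbb R:\Lambda(\vartheta)<\infty\}$. The tilted law $\mathbf P_\vartheta$ (expectation $\mathbf E_\vartheta$) has density $\Pi_n^\vartheta e^{-n\Lambda(\vartheta)}$ with respect to $\mathbf P$ on the first $n$ environmental marks, for every $n$; conditional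 on the environment, the reproduction and immigration mechanisms (and the initial state) are unchanged. *)

(* Defs.v *)
From HB Require Import structures.
From mathcomp Require Import all_boot all_order all_algebra.
From mathcomp Require Import all_classical all_reals all_analysis.
Import Order.TTheory GRing.Theory Num.Theory.
Import numFieldNormedType.Exports.

Set Implicit Arguments.
Unset Strict Implicit.
Unset Printing Implicit Defensive.

Local Open Scope classical_set_scope.
Local Open Scope ring_scope.
Local Open Scope ereal_scope.

(* Mutual independence of a family [G] of classes of events: the product rule
   along every finite injective list [i] of indices. *)
Definition mutually_independent d (T : measurableType d) (R : realType)
    (P : probability T R) (I : Type) (G : I -> set (set T)) : Prop :=
  forall (n : nat) (i : 'I_n -> I) (E : 'I_n -> set T),
    injective i -> (forall k, G (i k) (E k)) ->
    P (\bigcap_(k in [set: 'I_n]) E k) = \prod_(k < n) P (E k).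

Definition has_law d d' (T : measurableType d) (S : measurableType d')
    (R : realType) (P : probability T R) (X : T -> S)
    (mu : probability S R) : Prop :=
  forall U : set S, measurable U -> P (X @^-1` U) = mu U.

(* E[Y; B] *)
Definition expectation_on d (T : measurableType d) (R : realType)
    (P : probability T R) (Y : T -> R) (B : set T) : \bar R :=
  'E_P[fun w => (Y w * \1_B w)%R].

(* The elementary sources of randomness; the pair (A_n, B_n) is one source, as
   A_n and B_n may depend on each other. *)
Variant source : Type :=
  | Offspring of nat & nat
  | Control of nat & nat
  | Mark of nat
  | Initial.

Definition source_events d (T : measurableType d)
    (xi L : nat -> nat -> T -> nat) (A B : nat -> T -> nat) (Z0 : T -> nat)
    (s : source) : set (set T) :=
  match s with
  | Offspring n j => preimage_set_system setT (xi n j) measurable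
  | Control n j => preimage_set_system setT (L n j) measurable
  | Mark n => preimage_set_system setT (fun w => (A n w, B n w)) measurable
  | Initial => preimage_set_system setT Z0 measurable
  end.

(* The second index of [xi] and [L], running over 1, 2, ... in the usual
   notation, runs over 0, 1, ... here. *)
Record individual_sum_model d (T : measurableType d) (R : realType)
    (P : probability T R) := IndividualSumModel {
  xi : nat -> nat -> {RV P >-> nat};
  L : nat -> nat -> {RV P >-> nat};
  A : nat -> {RV P >-> nat};
  B : nat -> {RV P >-> nat};
  Z0 : {RV P >-> nat};
  xi_law : probability nat R;
  L_law : probability nat R;
  mark_law : probability (nat * nat)%type R;
  m : R;
  lambda : R;
  A_gt0 : forall n w, (0 < A n w)%N;
  xi_distr : forall n j, has_law P (xi n j) xi_law;
  L_distr : forall n j, has_law P (L n j) L_law;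
  mark_distr : forall n, has_law P (fun w => (A n w, B n w)) mark_law;
  m_gt0 : (0 < m)%R;
  lambda_gt0 : (0 < lambda)%R;
  xi_mean : \int[xi_law]_k (k%:R)%:E = m%:E;
  L_mean : \int[L_law]_k (k%:R)%:E = lambda%:E;
  sources_independent :
    mutually_independent P (source_events xi L A B Z0)
}.

Section model.
Context d (T : measurableType d) (R : realType) (P : probability T R).
Variable S : individual_sum_model P.

Definition control (n z : nat) (w : T) : nat :=
  (A S n w * (\sum_(j < z) L S n j w) + B S n w)%N.

Fixpoint Z (n : nat) (w : T) : nat :=
  if n is k.+1 then (\sum_(j < control k (Z k w) w) xi S k j w)%N
  else Z0 S w.

Definition M (n : nat) (w : T) : R := (m S * lambda S * (A S n w)%:R)%R.

Definition Pi (n : nat) (w : T) : R := (\prod_(j < n) M j w)%R.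

Definition V (n : nat) (w : T) : R := ((Z n w)%:R / Pi n w)%R.

Definition Lambda (theta : R) : \bar R := lne 'E_P[fun w => (M 0 w `^ theta)%R].

Definition D_Lambda : set R := [set theta | Lambda theta < +oo].

Definition events (s : source) : set (set T) :=
  source_events (xi S) (L S) (A S) (B S) (Z0 S) s.

Definition marks_before (n : nat) : set (set T) :=
  <<s \bigcup_(j in [set j | (j < n)%N]) events (Mark j) >>.

Definition environment : set (set T) :=
  <<s \bigcup_(j in [set: nat]) events (Mark j) >>.

(* sigma-algebra of the reproduction variables (used also by the immigrants),
   the control variables and the initial state *)
Definition mechanisms : set (set T) :=
  <<s \bigcup_(s in [set s | forall j, s <> Mark j]) events s >>.

(* [Q] is the tilted law P_theta. Under [P] the mechanisms are independent of
   the environment, so the conditional law given the environment that must be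
   kept is the (constant) restriction of [P] to [mechanisms]; the second clause
   says that Q(F | environment) = P F, Q-almost surely, for all [F] there. *)
Definition is_tilted_law (theta : R) (Q : probability T R) : Prop :=
  (forall (n : nat) (E : set T), marks_before n E ->
     Q E = \int[P]_(w in E)
             ((Pi n w `^ theta)%:E * expeR (- (n%:R%:E * Lambda theta)))) /\
  (forall E F : set T, environment E -> mechanisms F ->
     Q (E `&` F) = Q E * P F).

End model.

(* Main.v *)
(* Everything is discrete, so the identity reduces to atoms: it suffices to
   compare, for every z and a_0, ..., a_(n-1), the masses under P and under the
   tilted law of {Z_n = z, A_0 = a_0, ..., A_(n-1) = a_(n-1)}. On the event that
   the first n marks take given values the density of the tilt is a constant c,
   and for cylinders inside that event Q = c P follows from the independence of
   the environment and the mechanisms under both laws. The pi-lambda theorem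
   extends Q = c P to the sigma-algebra generated by the cylinders, with respect
   to which Z_n is measurable. It remains to use that
   V_n^theta Pi_n^theta = Z_n^theta and to sum over the atoms. *)

Require Import Defs.
From HB Require Import structures.
From mathcomp Require Import all_boot all_order all_algebra.
From mathcomp Require Import all_classical all_reals all_analysis.
From mathcomp Require Import measurable_realfun.
From mathcomp Require Import ring.
Set Implicit Arguments.
Unset Strict Implicit.

Import Order.TTheory GRing.Theory Num.Theory.
Import numFieldNormedType.Exports.
Local Open Scope classical_set_scope.
Local Open Scope ring_scope.
Local Open Scope ereal_scope.

(** * Measurability and integration along countably many fibres *)

Lemma measurable_fun_nat_fibers d (T : measurableType d) (f : T -> nat) :
  (forall k, measurable (f @^-1` [set k])) -> measurable_fun setT f.
Proof.
move=> mf _ Y _; rewrite setTI.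
have -> : f @^-1` Y = \bigcup_(k in Y) f @^-1` [set k].
  by apply/seteqP; split=> [w Yw|w [k Yk /= ->]//]; exists (f w).
exact: bigcup_measurable.
Qed.

(** Splitting along the values of [N] leaves a fixed index on each piece; this handles sums with a
    random number of terms. *)
Lemma measurable_fun_nat_index d d' (T : measurableType d)
    (U : measurableType d') (N : T -> nat) (F : nat -> T -> U) :
  measurable_fun setT N -> (forall k, measurable_fun setT (F k)) ->
  measurable_fun setT (fun w => F (N w) w).
Proof.
move=> mN mF _ Y mY; rewrite setTI.
have -> : (fun w => F (N w) w) @^-1` Y
    = \bigcup_k (N @^-1` [set k] `&` F k @^-1` Y).
  apply/seteqP; split=> [w Yw|w [k _ [/= -> //]]].
  by exists (N w).
apply: bigcup_measurable => k _; apply: measurableI.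
  by rewrite -[X in measurable X]setTI; exact: mN.
by rewrite -[X in measurable X]setTI; exact: mF.
Qed.

Lemma measurable_fun_nat_op d (T : measurableType d) (op : nat -> nat -> nat)
    (X Y : T -> nat) :
  measurable_fun setT X -> measurable_fun setT Y ->
  measurable_fun setT (fun w => op (X w) (Y w)).
Proof.
move=> mX mY; apply: (@measurable_fun_nat_index _ _ _ _ X (fun k w => op k (Y w))) => // k.
by apply: (@measurableT_comp _ _ _ _ _ _ (op k)).
Qed.

Lemma measurable_fun_nat_sum d (T : measurableType d) (N : T -> nat)
    (X : nat -> T -> nat) :
  measurable_fun setT N -> (forall j, measurable_fun setT (X j)) ->
  measurable_fun setT (fun w => \sum_(j < N w) X j w)%N.
Proof.
move=> mN mX.
apply: (@measurable_fun_nat_index _ _ _ _ N (fun k w => \sum_(j < k) X j w)%N) => //.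
elim=> [|k IH].
  by under eq_fun do rewrite big_ord0; exact: measurable_cst.
by under eq_fun do rewrite big_ord_recr /=; exact: measurable_fun_nat_op.
Qed.

(** Every subset of [nat] is measurable, so any preimage under [f] can be written as the
    [kappa]-preimage of its own image. *)
Lemma measurable_fun_nat_factor d d' (T : measurableType d)
    (U : measurableType d') (kappa : T -> nat) (f : T -> U) :
  measurable_fun setT kappa ->
  (forall w w', kappa w = kappa w' -> f w = f w') -> measurable_fun setT f.
Proof.
move=> mk fk _ Y mY.
have -> : setT `&` f @^-1` Y = setT `&` kappa @^-1` (kappa @` (f @^-1` Y)).
  rewrite !setTI; apply/seteqP; split=> [w Yw|w /= [w' Yw' /fk <-//]].
  by exists w.
exact: mk.
Qed.

(** Both integrals split into series over the fibres of [kappa], where the integrands are constant,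
    so the last hypothesis compares them term by term. *)
Lemma ge0_integral_nat_fibers d (T : measurableType d) (R : realType)
    (mu nu : {measure set T -> \bar R}) (e : R) (kappa : T -> nat)
    (f g : T -> \bar R) :
  measurable_fun setT kappa ->
  (forall w, 0 <= f w) -> (forall w, 0 <= g w) ->
  (forall w w', kappa w = kappa w' -> f w = f w') ->
  (forall w w', kappa w = kappa w' -> g w = g w') ->
  (forall w, f w * mu (kappa @^-1` [set kappa w])
    = e%:E * (g w * nu (kappa @^-1` [set kappa w]))) ->
  \int[mu]_w f w = e%:E * \int[nu]_w g w.
Proof.
move=> mk f0 g0 fk gk H.
have mF k : measurable (kappa @^-1` [set k]).
  by rewrite -[X in measurable X]setTI; exact: mk.
have UT : setT = \bigcup_k kappa @^-1` [set k].
  by apply/esym/seteqP; split=> // w _; exists (kappa w).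
have tF : trivIset setT (fun k => kappa @^-1` [set k]).
  by apply/trivIsetP => i j _ _ /eqP ij; rewrite -subset0 => w [/= wi wj]; apply: ij; rewrite -wi -wj.
have cst_int (rho : {measure set T -> \bar R}) (h : T -> \bar R) w :
    (forall w w', kappa w = kappa w' -> h w = h w') ->
    \int[rho]_(x in kappa @^-1` [set kappa w]) h x
      = h w * rho (kappa @^-1` [set kappa w]).
  move=> hk; rewrite -integral_cst//; apply: eq_integral => x.
  by rewrite inE => /= /hk.
have mfib (h : T -> \bar R) : (forall w w', kappa w = kappa w' -> h w = h w') ->
    measurable_fun (\bigcup_k kappa @^-1` [set k]) h.
  by rewrite -UT; exact: measurable_fun_nat_factor.
rewrite UT !ge0_integral_bigcup//; [|exact: mfib..].
rewrite -nneseriesZl; last by move=> k _; exact: integral_ge0.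
apply: eq_eseriesr => k _.
(* An empty fibre contributes zero; any other is the fibre of some point [w], as the hypothesis
   requires. *)
have [->|/set0P[w /= <-]] := eqVneq (kappa @^-1` [set k]) set0.
  by rewrite !integral_set0 mule0.
by rewrite !cst_int.
Qed.

(** Classical equality on sources, so that finite sets of them can be given as lists. *)
HB.instance Definition _ := gen_eqMixin source.
HB.instance Definition _ := gen_choiceMixin source.

(** * Cylinder events and independence of marks and mechanisms *)

Section cylinders.
Context d (T : measurableType d) (R : realType) (P : probability T R).
Variable S : individual_sum_model P.

Lemma measurable_mark j : measurable_fun setT (fun w => (A S j w, B S j w)).
Proof. by apply/measurable_fun_pair. Qed.

Lemma eventsT s : events S s setT.
Proof. by case: s => * /=; exists setT => //; rewrite setTI. Qed.

Lemma eventsI s : setI_closed (events S s).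
Proof.
by case: s => *; move=> _ _ [U mU <-] [V mV <-]; exists (U `&` V);
  rewrite ?setTI ?preimage_setI//; exact: measurableI.
Qed.

Lemma events_measurable s : events S s `<=` measurable.
Proof.
have mp := measurable_mark.
by case: s => *; move=> _ [U mU <-]; rewrite /=; first [exact: mp | exact: measurable_funPT].
Qed.

(** All constrained sources lie in a list because independence gives the product rule along finite
    families only. *)
Definition supported (l : seq source) (E : source -> set T) :=
  forall s, s \notin l -> E s = setT.

Lemma bigcap_supported l E : supported l E ->
  \bigcap_s E s = \bigcap_(s in [set` l]) E s.
Proof.
move=> lE; apply/seteqP; split=> w Ew s /= sl; first exact: Ew.
by have [/Ew//|/lE->] := boolP (s \in l).
Qed.

Lemma prob_bigcap l E : uniq l -> supported l E ->
  (forall s, events S s (E s)) ->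
  P (\bigcap_s E s) = \prod_(s <- l) P (E s).
Proof.
move=> ul lE ES; rewrite (bigcap_supported lE) big_tnth.
rewrite -(@sources_independent _ _ _ _ S (size l) (tnth (in_tuple l))
  (fun k => E (tnth (in_tuple l) k))).
- congr (P _); apply/seteqP; split=> [w Ew k _|w Ew s /= sl].
    by apply: Ew => /=; exact: mem_tnth.
  have /(nthP s)[i il <-] := sl.
  by have := Ew (Ordinal il) I; rewrite (tnth_nth s).
- by apply/tuple_uniqP.
- by move=> k; exact: ES.
Qed.

Definition mark_part (E : source -> set T) s :=
  if s is Mark _ then E s else setT.

Definition mechanism_part (E : source -> set T) s :=
  if s is Mark _ then setT else E s.

(** This split has the shape of the second clause of [is_tilted_law]: an environment event
    intersected with a mechanism event. *)
Lemma bigcap_parts E : \bigcap_s E s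
  = \bigcap_s mark_part E s `&` \bigcap_s mechanism_part E s.
Proof.
apply/seteqP; split=> [w Ew|w [E1 E2] s _].
  by split=> -[] *; rewrite /mark_part /mechanism_part//; exact: Ew.
by move: (E1 s I) (E2 s I); case: s.
Qed.

(* The sides of a cylinder on the mechanisms and on the marks before time n;
   sources that are not constrained have the side [setT]. *)
Definition cylinder_sides (n : nat) (E : source -> set T) :=
  [/\ forall s, events S s (E s), exists l, supported l E
    & forall j, (n <= j)%N -> E (Mark j) = setT].

Definition cylinders n : set (set T) :=
  [set C | exists2 E, cylinder_sides n E & C = \bigcap_s E s].

Lemma cylinder_sidesI n E F : cylinder_sides n E -> cylinder_sides n F ->
  cylinder_sides n (fun s => E s `&` F s).
Proof.
move=> [ES [l lE] nE] [FS [l' lF] nF]; split=> [s||j nj].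
- exact: eventsI.
- exists (l ++ l') => s; rewrite mem_cat negb_or => /andP[sl sl'].
  by rewrite lE// lF// setIT.
- by rewrite nE// nF// setIT.
Qed.

Lemma cylindersI n : setI_closed (cylinders n).
Proof.
move=> _ _ [E nE ->] [F nF ->]; exists (fun s => E s `&` F s).
  exact: cylinder_sidesI.
by rewrite bigcapI.
Qed.

Lemma cylinder_source n s U : (if s is Mark j then (j < n)%N else true) ->
  events S s U -> cylinders n U.
Proof.
move=> sn sU; exists (fun s' => if s' == s then U else setT); last first.
  apply/seteqP; split=> [w Uw s' _|w /(_ s I)]; first by case: eqP.
  by rewrite eqxx.
split=> [s'||j nj].
- by case: eqP => [->//|_]; exact: eventsT.
- by exists [:: s] => s'; rewrite inE => /negbTE->.
- case: eqP => // Es; move: sn; rewrite -Es => jn.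
  by move: (leq_trans jn nj); rewrite ltnn.
Qed.

Lemma cylindersT n : cylinders n setT.
Proof. by apply: (@cylinder_source n Initial) => //; exact: (eventsT Initial). Qed.

Lemma cylinders_measurable n : cylinders n `<=` measurable.
Proof.
move=> _ [E [ES [l lE] _] ->]; rewrite (bigcap_supported lE).
apply: fin_bigcap_measurable => [|s _]; first exact: finite_seq.
exact: events_measurable.
Qed.

Lemma g_sigma_bigcap (G : set (set T)) l E : supported l E ->
  (forall s, <<s G >> (E s)) -> <<s G >> (\bigcap_s E s).
Proof.
move=> lE GE; rewrite (bigcap_supported lE).
apply: (@fin_bigcap_measurable _ (g_sigma_algebraType G)) => [|s _].
  exact: finite_seq.
exact: GE.
Qed.

Lemma g_sigmaT (G : set (set T)) : <<s G >> setT.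
Proof. exact: (@measurableT _ (g_sigma_algebraType G)). Qed.

Lemma marks_before_part n E : cylinder_sides n E ->
  marks_before S n (\bigcap_s mark_part E s).
Proof.
move=> [ES [l lE] nE]; apply: (@g_sigma_bigcap _ l).
  by case=> *; rewrite /mark_part// lE.
case=> [? ?|? ?|j|] /=; try exact: g_sigmaT.
have [jn|/nE->] := ltnP j n; last exact: g_sigmaT.
by apply: sub_sigma_algebra; exists j => //; exact: (ES (Mark j)).
Qed.

Lemma marks_before_environment n : marks_before S n `<=` environment S.
Proof. by apply: sub_sigma_algebra2 => U [j _ jU]; exists j. Qed.

Lemma mechanisms_part n E : cylinder_sides n E ->
  mechanisms S (\bigcap_s mechanism_part E s).
Proof.
move=> [ES [l lE] nE]; apply: (@g_sigma_bigcap _ l).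
  by case=> *; rewrite /mechanism_part// lE.
have mE s : (forall j, s <> Mark j) -> mechanisms S (E s).
  by move=> sM; apply: sub_sigma_algebra; exists s => //; exact: (ES s).
by case=> [i j|i j|j|]; [exact: mE|exact: mE|exact: g_sigmaT|exact: mE].
Qed.

(** One list of sources supports all three intersections; at each source one of the two parts is
    [setT], of probability one, so the products agree factor by factor. *)
Lemma prob_parts n E : cylinder_sides n E ->
  P (\bigcap_s E s)
  = P (\bigcap_s mark_part E s) * P (\bigcap_s mechanism_part E s).
Proof.
move=> [ES [l lE] nE].
(* The product rule asks for an injective enumeration of the sources, hence [undup]. *)
have uE F : (forall s, E s = setT -> F s = setT) -> supported (undup l) F.
  by move=> EF s; rewrite mem_undup => /lE /EF.
rewrite !(@prob_bigcap (undup l)) ?undup_uniq//; first last.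
- exact: uE.
- by move=> s; move: (ES s) (eventsT s); case: s.
- by apply: uE; case.
- by move=> s; move: (ES s) (eventsT s); case: s.
- by apply: uE; case.
rewrite -big_split; apply: eq_bigr => s _.
by case: s => *; rewrite /= /mark_part /mechanism_part probability_setT ?mul1e ?mule1.
Qed.


(** * Measurability of the process for the sigma-algebra of cylinders *)

Section sigma_cylinders.
Variable n : nat.
Let Tn : measurableType _ := g_sigma_algebraType (cylinders n).

Lemma measurable_offspring i j : measurable_fun (setT : set Tn) (xi S i j).
Proof.
move=> _ Y mY; apply: sub_sigma_algebra.
by apply: (@cylinder_source n (Offspring i j)) => //; exists Y.
Qed.

Lemma measurable_control_var i j : measurable_fun (setT : set Tn) (L S i j).
Proof.
move=> _ Y mY; apply: sub_sigma_algebra.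
by apply: (@cylinder_source n (Control i j)) => //; exists Y.
Qed.

Lemma measurable_initial : measurable_fun (setT : set Tn) (Z0 S).
Proof.
move=> _ Y mY; apply: sub_sigma_algebra.
by apply: (@cylinder_source n Initial) => //; exists Y.
Qed.

Lemma measurable_A j : (j < n)%N -> measurable_fun (setT : set Tn) (A S j).
Proof.
move=> jn _ Y mY; apply: sub_sigma_algebra.
apply: (@cylinder_source n (Mark j)) => //; exists (Y `*` setT).
  exact: measurableX.
by rewrite !setTI; apply/seteqP; split=> w //= [].
Qed.

Lemma measurable_B j : (j < n)%N -> measurable_fun (setT : set Tn) (B S j).
Proof.
move=> jn _ Y mY; apply: sub_sigma_algebra.
apply: (@cylinder_source n (Mark j)) => //; exists (setT `*` Y).
  exact: measurableX.
by rewrite !setTI; apply/seteqP; split=> w //= [].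
Qed.

(** Generation [k.+1] involves marks up to time [k] only, and these are all before time [n] when
    [k.+1 <= n]. *)
Lemma measurable_Z k : (k <= n)%N -> measurable_fun (setT : set Tn) (Z S k).
Proof.
elim: k => [_|k IH kn] /=; first exact: measurable_initial.
apply: (@measurable_fun_nat_sum _ Tn
  (fun w => control S k (Z S k w) w) (fun j => xi S k j)) => [|j].
  2: exact: measurable_offspring.
rewrite /control.
apply: (@measurable_fun_nat_op _ Tn addn); last exact: measurable_B.
apply: (@measurable_fun_nat_op _ Tn muln); first exact: measurable_A.
apply: (@measurable_fun_nat_sum _ Tn (Z S k) (fun j => L S k j)) => [|j].
  by apply: IH; exact: ltnW.
exact: measurable_control_var.
Qed.

End sigma_cylinders.

(** Only the [A] components are fixed: [Pi] depends on nothing else in the marks. *)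
Definition mark_fiber n w0 : set T :=
  [set w | forall j, (j < n)%N -> A S j w = A S j w0].

Definition mark_fiber_sides n w0 s : set T :=
  if s is Mark j then if (j < n)%N then [set w | A S j w = A S j w0] else setT
  else setT.

Lemma bigcap_mark_fiber n w0 :
  \bigcap_s mark_fiber_sides n w0 s = mark_fiber n w0.
Proof.
apply/seteqP; split=> [w H j jn|w H [] * //=]; first by have := H (Mark j) I; rewrite /= jn.
by case: ifP => // /H.
Qed.

Lemma cylinder_mark_fiber n w0 : cylinder_sides n (mark_fiber_sides n w0).
Proof.
split=> [s||j nj]; last by rewrite /= ltnNge nj.
- case: s => [i j|i j|j|]; try exact: eventsT.
  rewrite /mark_fiber_sides; case: ifP => _; last exact: (eventsT (Mark j)).
  exists ([set A S j w0] `*` setT); first exact: measurableX.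
  by rewrite setTI; apply/seteqP; split=> w //= [].
- exists [seq Mark j | j <- iota 0 n] => -[] //= j.
  by case: ifP => // jn /negP[]; apply: map_f; rewrite mem_iota.
Qed.

Lemma cylinder_mark_part n E :
  cylinder_sides n E -> cylinder_sides n (mark_part E).
Proof.
move=> [ES [l lE] nE]; split=> //.
- by move=> s; move: (ES s) (eventsT s); case: s.
- by exists l; case=> // j /lE.
Qed.

Lemma bigcap_cylinder_measurable n E :
  cylinder_sides n E -> measurable (\bigcap_s E s).
Proof. by move=> nE; apply: (@cylinders_measurable n); exists E. Qed.

Lemma measurable_mark_fiber n w0 : measurable (mark_fiber n w0).
Proof.
rewrite -bigcap_mark_fiber.
exact: bigcap_cylinder_measurable (cylinder_mark_fiber n w0).
Qed.

Lemma Pi_gt0 n w : (0 < Pi S n w)%R.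
Proof.
apply: prodr_gt0 => j _; rewrite !mulr_gt0 ?ltr0n//.
- exact: m_gt0.
- exact: lambda_gt0.
- exact: A_gt0.
Qed.

Lemma eq_Pi n w w0 : mark_fiber n w0 w -> Pi S n w = Pi S n w0.
Proof. by move=> H; apply: eq_bigr => j _; rewrite /M H. Qed.

(** * The tilted law as a constant multiple of [P] on a mark fibre *)

Section tilted.
Variables (theta : R) (Q : probability T R).
Hypothesis tilted : is_tilted_law S theta Q.

(* An infinite Lambda would make the density of the first mark identically
   0 or +oo, contradicting Q setT = 1. *)
Lemma Lambda_fin_num : Lambda S theta \is a fin_num.
Proof.
have marksT : marks_before S 1 setT by exact: g_sigmaT.
have [/(_ _ _ marksT) + _] := tilted.
rewrite probability_setT; case: (Lambda S theta) => [//||].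
  rewrite mul1e/= integral0_eq; last by move=> w _; rewrite mule0.
  by move/eqP; rewrite onee_eq0.
rewrite mul1e/=.
rewrite (eq_integral (cst +oo)) => [|w _]; last first.
  by rewrite gt0_muley// lte_fin powR_gt0// Pi_gt0.
by rewrite integral_cst// [X in +oo * X](@probability_setT _ _ _ P) mule1.
Qed.

Let lam := fine (Lambda S theta).

(* The density of [Q] with respect to [P] on the first n marks, at w0. *)
Definition tilt_weight n w0 : R :=
  (Pi S n w0 `^ theta * expR (- (n%:R * lam)))%R.

(** [P] and [Q] both factor into marks and mechanisms and agree on the mechanisms. On the mark part
    [Pi] is frozen at its value at [w0], so the density integrates to the weight times the
    probability. *)
Lemma tilted_cylinder n w0 E : cylinder_sides n E ->
  (forall j, (j < n)%N -> E (Mark j) `<=` [set w | A S j w = A S j w0]) ->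
  Q (\bigcap_s E s) = (tilt_weight n w0)%:E * P (\bigcap_s E s).
Proof.
move=> nE Ew0; have [QP QI] := tilted; have Em := marks_before_part nE.
rewrite (prob_parts nE) bigcap_parts QI; last exact: mechanisms_part nE.
2: exact: marks_before_environment Em.
rewrite (QP n)// muleA; congr (_ * _).
rewrite -integral_cst; last first.
  exact: bigcap_cylinder_measurable (cylinder_mark_part nE).
apply: eq_integral => w; rewrite inE => Ew.
rewrite -(fineK Lambda_fin_num) -/lam /= /tilt_weight -EFinM -(@eq_Pi n w w0)//.
by move=> j jn; apply: (Ew0 j jn); exact: (Ew (Mark j)).
Qed.

Lemma tilt_weight_ge0 n w0 : (0 <= tilt_weight n w0)%R.
Proof. by rewrite mulr_ge0 ?powR_ge0 ?expR_ge0. Qed.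

(** Uniqueness of measures on a pi-system, applied to [Q] and the rescaled [P], both restricted to
    the fibre. *)
Lemma tilted_fiber n w0 G : <<s cylinders n >> G ->
  Q (G `&` mark_fiber n w0)
  = (tilt_weight n w0)%:E * P (G `&` mark_fiber n w0).
Proof.
have mF := measurable_mark_fiber n w0.
pose k := NngNum (tilt_weight_ge0 n w0).
apply: (@g_sigma_algebra_measure_unique _ R T (cylinders n) _ (fun=> setT) _ _
  (mrestr Q mF) (mscale k (mrestr P mF))).
- exact: cylinders_measurable.
- by move=> _; exact: cylindersT.
- by apply/seteqP; split=> // w _; exists 0%N.
- exact: cylindersI.
- move=> _ [E nE ->]; change (Q (\bigcap_s E s `&` mark_fiber n w0)
    = (tilt_weight n w0)%:E * P (\bigcap_s E s `&` mark_fiber n w0)).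
  (* The fibre is itself a cylinder; merging its sides with those of [E] forces the values of [A]
     that [tilted_cylinder] asks for. *)
  rewrite -bigcap_mark_fiber -bigcapI.
  apply: tilted_cylinder; first exact: cylinder_sidesI (cylinder_mark_fiber _ _).
  by move=> j jn w [_]; rewrite /= jn.
(* The constant exhausting sequence [setT] is admissible since the restricted [Q] has mass at most
   1. *)
- move=> _; apply: (@le_lt_trans _ _ 1); last exact: ltry.
  by apply: probability_le1; exact: measurableI.
Qed.

End tilted.
End cylinders.

(** * Atoms of the population size and the first control marks *)

Section fibers.
Context d (T : measurableType d) (R : realType) (P : probability T R).
Variable S : individual_sum_model P.

(** [pickle] codes the pair as one natural number, so that the atoms become the fibres in
    [ge0_integral_nat_fibers]. *)
Definition population_and_marks n w : nat :=
  pickle (Z S n w, mkseq (fun j => A S j w) n).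

Lemma population_and_marksP n w w0 :
  population_and_marks n w = population_and_marks n w0 <->
  Z S n w = Z S n w0 /\ mark_fiber S n w0 w.
Proof.
split=> [/(pcan_inj pickleK)[ZE AE]|[ZE AE]].
  split=> // j jn; have := congr1 (fun s => nth 0%N s j) AE.
  by rewrite !nth_mkseq.
congr pickle; rewrite /population_and_marks ZE; congr pair.
by apply/eq_in_map => j; rewrite mem_iota => /AE.
Qed.

Lemma population_and_marks_fiber n w0 :
  population_and_marks n @^-1` [set population_and_marks n w0]
  = (Z S n @^-1` [set Z S n w0]) `&` mark_fiber S n w0.
Proof. by apply/seteqP; split=> w /= /population_and_marksP. Qed.

Lemma Z_fiber_cylinders n z : <<s cylinders S n >> (Z S n @^-1` [set z]).
Proof.
rewrite -[X in <<s _ >> X]setTI.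
exact: (measurable_Z (leqnn n)).
Qed.

Lemma measurable_population_and_marks n :
  measurable_fun setT (population_and_marks n).
Proof.
apply: measurable_fun_nat_fibers => k.
have [->//|/set0P[w0 /= <-]] :=
  eqVneq (population_and_marks n @^-1` [set k]) set0.
rewrite population_and_marks_fiber; apply: measurableI.
  have sG : <<s cylinders S n >> `<=` measurable.
    apply: smallest_sub; first exact: sigma_algebra_measurable.
    exact: cylinders_measurable.
  by apply: sG; exact: Z_fiber_cylinders.
exact: measurable_mark_fiber.
Qed.

End fibers.

(** * The change-of-measure identity, summed over atoms *)

Unset Implicit Arguments.
Set Strict Implicit.

Theorem proposition2p7 (d : measure_display) (T : measurableType d)
    (R : realType) (P : probability T R) (S : individual_sum_model P)
    (r : R) (r_gt0 : (0 < r)%R)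
    (r_int : interior (D_Lambda S) (- r)%R)
    (Q : probability T R) (tilted : is_tilted_law S (- r)%R Q)
    (n : nat) :
  expectation_on P (fun w => ((Z S n w)%:R `^ (- r))%R)
    [set w | (0 < Z S n w)%N]
  = expeR (n%:R%:E * Lambda S (- r)%R)
    * expectation_on Q (fun w => (V S n w `^ (- r))%R)
        [set w | (0 < Z S n w)%N].
Proof.
rewrite /expectation_on !unlock.
rewrite -(fineK (Lambda_fin_num tilted)) -EFinM [expeR _]/=.
have indicE w w' : Z S n w = Z S n w' ->
    \1_[set w | (0 < Z S n w)%N] w = \1_[set w | (0 < Z S n w)%N] w' :> R.
  by move=> ZE; rewrite !indicE; congr (nat_of_bool _)%:R; apply/idP/idP;
    rewrite !inE/= ZE.
apply: (@ge0_integral_nat_fibers _ _ _ _ _ _ (population_and_marks S n)).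
- exact: measurable_population_and_marks.
- by move=> w; rewrite lee_fin mulr_ge0 ?powR_ge0.
- by move=> w; rewrite lee_fin mulr_ge0 ?powR_ge0.
- by move=> w w' /population_and_marksP[ZE _]; rewrite (indicE _ _ ZE) ZE.
- move=> w w' /population_and_marksP[ZE /eq_Pi PE].
  by rewrite (indicE _ _ ZE) /V ZE PE.
move=> w.
rewrite population_and_marks_fiber.
(* The [Q]-mass of the atom becomes [tilt_weight] times its [P]-mass, which leaves an identity
   between real constants. *)
rewrite [X in _ * (_ * X)](tilted_fiber tilted w
  (@Z_fiber_cylinders _ _ _ _ S n (Z S n w))).
rewrite !muleA -!EFinM; congr (_%:E * _).
have Pi0 := Pi_gt0 S n w.
(* [powRM] asks only for nonnegative bases, so atoms with [Z S n w = 0] are covered as well. *)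
have -> : ((Z S n w)%:R `^ (- r) = V S n w `^ (- r) * Pi S n w `^ (- r))%R.
  by rewrite -powRM; rewrite ?divr_ge0// ?(ltW Pi0)//; rewrite /V divfK// gt_eqF.
(* The exponential in the weight is the inverse of the prefactor, and the two cancel. *)
rewrite /tilt_weight expRN.
by field; rewrite gt_eqF// expR_gt0.
Qed.
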